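(* Let $d\ge 1$ and $n\ge 1$ be integers and let $L$ be a finite graded lattice of rank $d+1$ whose set of atoms $A$ satisfies $|A| \geq n(d+1)$. Let $C$ be the set of coatoms of $L$. Then $m=\tau(d,n)$ satisfies $$\min_{Z \subset A,\ |Z|=m} |\Gamma(Z)| \leq \frac{d}{d+1}\Big(\max_{a \in A} |C_a| + |C|\Big).$$
   Context: A finite lattice $L$ has minimum $\hat 0$ and maximum $\hat 1$; it is graded with rank function $\mathrm{rk}$ if $\mathrm{rk}(\hat 0)=0$ and $\mathrm{rk}(y)=\mathrm{rk}(x)+1$ whenever $y$ covers $x$; its rank is $\mathrm{rk}(\hat 1)$. Atoms are elements of rank $1$, coatoms elements of rank $d$. For $a\in A$, $C_a=\{c\in C: a\le c\}$, and for $Z\subset A$, $\Gamma(Z)=\bigcup_{z\in Z} C_z$. The topological Pach number $\tau(d,n)$ is defined as follows. Simplicial complexes are identified with geometric realizations, and $\langle v_0,\ldots,v_k\rangle$ denotes the geometric simplex on $\{v_0,\ldots,v_k\}$. Let $V_1,\ldots,V_{d+1}$ be pairwise disjoint $n$-element sets and $V_1*\cdots*V_{d+1}=\{\sigma\subset\bigcup_i V_i: |\sigma\cap V_i|\le 1\ \forall i\}$ their join. For continuous $f:V_1*\cdots*V_{d+1}\to\mathbb{R}^d$, $\tau(f)$ is the maximal $m$ such that there are $m$-element $Z_i\subset V_i$ ($1\le i\le d+1$) with $\bigcap_{z_i\in Z_i} f(\langle z_1,\ldots,z_{d+1}\rangle)\ne\emptyset$; $\tau(d,n)$ is the minimum of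 $\tau(f)$ over all such continuous $f$. *)

(* Defs.v *)
From HB Require Import structures.
From mathcomp Require Import all_boot all_order all_algebra.
From mathcomp Require Import all_classical all_reals all_analysis.

Set Implicit Arguments.
Unset Strict Implicit.
Unset Printing Implicit Defensive.

Import Order.TTheory GRing.Theory Num.Theory.
Import numFieldNormedType.Exports.

Section GradedLattice.
Context {disp : Order.disp_t} {L : finTBLatticeType disp}.
Implicit Types (x y a : L) (rk : L -> nat) (Z : {set L}).

Definition covers x y : bool :=
  (x < y)%O && [forall z : L, ~~ (x < z < y)%O].

Definition is_rank rk : Prop :=
  rk \bot%O = 0%N /\ forall x y, covers x y -> rk y = (rk x).+1.

Definition atoms rk : {set L} := [set x | rk x == 1%N]%SET.

(* The parameter d is one less than the rank of the lattice. *)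
Definition coatoms rk (d : nat) : {set L} := [set x | rk x == d]%SET.

Definition coatoms_above rk (d : nat) a : {set L} :=
  [set c in coatoms rk d | (a <= c)%O]%SET.

Definition Gamma rk (d : nat) Z : {set L} :=
  (\bigcup_(z in Z) coatoms_above rk d z)%SET.

(* #|coatoms| bounds every #|Gamma Z| from above, so using it as the default
   value of the iterated minimum does not change the minimum when
   m <= #|atoms|. *)
Definition min_Gamma rk (d m : nat) : nat :=
  \big[minn/#|coatoms rk d|]_(Z : {set L} | (Z \subset atoms rk) && (#|Z| == m))
     #|Gamma rk d Z|.

Definition max_coatoms_above rk (d : nat) : nat :=
  \max_(a in atoms rk) #|coatoms_above rk d a|.

End GradedLattice.

Section Join.
Variables d n : nat.

(* The n-element sets V_0, ..., V_d are the fibres of the first projection. *)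
Definition vertex : finType := ('I_d.+1 * 'I_n)%type.

Definition V (i : 'I_d.+1) : {set vertex} := [set v | v.1 == i]%SET.

Definition join_complex : {set {set vertex}} :=
  [set s : {set vertex} | [forall i, #|s :&: V i| <= 1]]%SET.

End Join.

Local Open Scope classical_set_scope.
Local Open Scope ring_scope.

(* Points of the realization of a finite complex are given by their barycentric
   coordinates, a subspace of R^T with the product topology. *)
Definition realization (R : realType) (T : finType) (K : {set {set T}}) :
    set {ptws T -> R} :=
  [set x | [/\ forall v, 0 <= x v,
               \sum_v x v = 1
             & [set v | x v != 0]%SET \in K]].

Definition geom_simplex (R : realType) (T : finType) (s : {set T}) :
    set {ptws T -> R} :=
  [set x | [/\ forall v, 0 <= x v,
               \sum_v x v = 1
             & [set v | x v != 0]%SET \subset s]].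

Section Pach.
Variables (R : realType) (d n : nat).

(* Only the values on the realization of the join matter. *)
Definition continuous_on_join (f : {ptws vertex d n -> R} -> 'rV[R]_d) : Prop :=
  {within realization (R := R) (join_complex d n), continuous f}.

(* z ranges over the choices of one vertex z i in each Z i. *)
Definition pach (f : {ptws vertex d n -> R} -> 'rV[R]_d) (m : nat) : Prop :=
  exists Z : 'I_d.+1 -> {set vertex d n},
    (forall i, Z i \subset V n i /\ #|Z i| = m) /\
    \bigcap_(z in [set z : 'I_d.+1 -> vertex d n | forall i, z i \in Z i])
       (f @` geom_simplex (R := R) [set z i | i in 'I_d.+1]%SET) !=set0.

(* A witness Z satisfies m <= n, so the range of m loses nothing. *)
Definition tau_map (f : {ptws vertex d n -> R} -> 'rV[R]_d) : nat :=
  (\max_(m < n.+1 | `[< pach f m >]) m)%N.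

Lemma tau_ex : exists m : nat,
  `[< exists2 f, continuous_on_join f & tau_map f = m >].
Proof.
exists (tau_map (fun=> 0)); apply/asboolP; exists (fun=> 0) => //.
by apply: continuous_subspaceT => x; exact: cst_continuous.
Qed.

Definition tau : nat := ex_minn tau_ex.

End Pach.

(* Main.v *)
(* Send each face s of the join to the lattice element joining the atoms at its
   vertices, put the elements of L in general position in R^d, and interpolate
   by convex combinations on the simplices of the barycentric subdivision.  Suppose that u lies in the images
   of all simplices spanned by Z_0, ..., Z_d.  A coatom c above some vertex of
   every Z_i then gives a chain below c whose hull, of dimension < d, contains u.
   By general position at most d such chains are pairwise disjoint, and in a
   maximal disjoint family of chains every other one meets a member, so c lies
   above one of at most d atoms.  Hence at most d max |C_a| coatoms are in all
   the Gamma(Z_i), the others are in at most d of them, and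
   sum_i |Gamma(Z_i)| <= d (max |C_a| + |C|). *)
Require Import Defs.
From HB Require Import structures.
From mathcomp Require Import all_boot all_order all_algebra.
From mathcomp Require Import all_classical all_reals all_analysis.

Set Implicit Arguments.
Unset Strict Implicit.
Unset Printing Implicit Defensive.

Import Order.TTheory GRing.Theory Num.Theory.
Import numFieldNormedType.Exports.
Local Open Scope ring_scope.

(** * Normals of hyperplanes through [d] points *)

Section Normals.
Variables (T : Type) (d : nat).

(** The square shape gives access to the adjugate, whose column [i] holds the cofactors along row
    [i], computed from the other [d] rows. *)
Definition point_mx (S : comNzRingType) (P : T -> 'rV[S]_d.+1)
    (s : 'I_d.+1 * 'I_d.+1 -> T) (i : 'I_d.+1) : 'M[S]_d.+1 :=
  \matrix_(j, k) P (s (i, j)) 0 k.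

(* Column i is a normal vector of the hyperplane spanned by the d points
   P (s (i, j)), j != i. *)
Definition normal_mx (S : comNzRingType) (P : T -> 'rV[S]_d.+1)
    (s : 'I_d.+1 * 'I_d.+1 -> T) : 'M[S]_d.+1 :=
  \matrix_(k, i) \adj (point_mx P s i) k i.

Lemma eq_normal_mx (S : comNzRingType) (P Q : T -> 'rV[S]_d.+1) s :
  P =1 Q -> normal_mx P s = normal_mx Q s.
Proof.
move=> PQ; apply/matrixP => k i; rewrite !mxE (_ : point_mx P s i = point_mx Q s i)//.
by apply/matrixP => a b; rewrite !mxE PQ.
Qed.

Lemma map_normal_mx (S S' : comNzRingType) (f : {rmorphism S -> S'})
    (P : T -> 'rV[S]_d.+1) s :
  map_mx f (normal_mx P s) = normal_mx (fun x => map_mx f (P x)) s.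
Proof.
apply/matrixP => k i; rewrite [LHS]mxE [in LHS]mxE [RHS]mxE.
have -> : point_mx (fun x => map_mx f (P x)) s i = map_mx f (point_mx P s i).
  by apply/matrixP => a b; rewrite !mxE.
by rewrite -map_mx_adj [RHS]mxE.
Qed.

(** Off the diagonal, [M *m \adj M] vanishes, so column [i] is orthogonal to every point
    [P (s (i, j))] with [j != i], hence to their span. *)
Lemma mul_normal_mx (S : comNzRingType) (P : T -> 'rV[S]_d.+1) s (u : 'rV_d.+1)
    (w : 'I_d.+1 -> 'I_d.+1 -> S) :
    (forall i, u = \sum_(j | j != i) w i j *: P (s (i, j))) ->
  u *m normal_mx P s = 0.
Proof.
move=> uE; apply/matrixP => z i; rewrite mxE [RHS]mxE ord1 {z}.
have -> : \sum_k u 0 k * normal_mx P s k i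
    = \sum_(j | j != i) w i j * (point_mx P s i *m \adj (point_mx P s i)) j i.
  transitivity (\sum_k \sum_(j | j != i)
      w i j * (point_mx P s i j k * \adj (point_mx P s i) k i)).
    apply: eq_bigr => k _; rewrite {1}(uE i) summxE mulr_suml.
    by apply: eq_bigr => j _; rewrite !mxE mulrA.
  by rewrite exchange_big; apply: eq_bigr => j _; rewrite -mulr_sumr [in RHS]mxE.
by apply: big1 => j ji; rewrite mul_mx_adj mxE (negbTE ji) mulr0n mulr0.
Qed.

End Normals.

(** * Points in general position *)

Section GenericPoints.
Variables (R : numFieldType) (d : nat).

Lemma poly_nonroot (p : {poly R}) : p != 0 -> exists t, p.[t] != 0.
Proof.
move=> p0; pose rs := [seq i%:R : R | i <- iota 0 (size p)].
have rs_uniq : uniq rs.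
  by rewrite map_inj_uniq ?iota_uniq// => i j /eqP; rewrite eqr_nat => /eqP.
have [/(max_poly_roots p0)/(_ rs_uniq)|/allPn[t _ ?]] := boolP (all (root p) rs).
  by rewrite size_map size_iota ltnn.
by exists t.
Qed.

(* On the line joining two configurations, a determinant of normals that is
   nonzero at one end is a nonzero polynomial, so it vanishes only finitely
   often. *)
Lemma generic_normals (T : finType)
    (ss : seq {ffun 'I_d.+1 * 'I_d.+1 -> T}) :
    (forall s, s \in ss -> injective s) ->
  exists2 P : T -> 'rV[R]_d.+1, (forall x, \sum_k P x 0 k = 1) &
    {in ss, forall s : {ffun _ -> _}, \det (normal_mx P s) != 0}.
Proof.
elim: ss => [_|s ss IH inj].
  exists (fun=> delta_mx 0 0) => // _.
  rewrite (bigD1 0)//= big1 ?addr0 ?mxE// => k /negbTE k0.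
  by rewrite mxE k0 andbF.
have [|P P1 Pss] := IH; first by move=> s' s'ss; apply: inj; rewrite inE s'ss orbT.
have s_inj : injective s by apply: inj; rewrite inE eqxx.
(* At Q the i-th hyperplane is the i-th coordinate hyperplane. *)
pose idx x := odflt 0 (omap snd [pick ij | s ij == x]).
pose Q x : 'rV[R]_d.+1 := delta_mx 0 (idx x).
have Q1 x : \sum_k Q x 0 k = 1.
  rewrite (bigD1 (idx x))//= big1 ?addr0 ?mxE ?eqxx// => k /negbTE kN.
  by rewrite mxE kN andbF.
have Qs : normal_mx Q s = 1%:M.
  apply/matrixP => k i; rewrite mxE.
  have -> : point_mx Q s i = 1%:M.
    apply/matrixP => a b; rewrite !mxE /idx.
    case: pickP => [ij /eqP/s_inj->|/(_ (i, a))]; last by rewrite eqxx.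
    by rewrite /= eq_sym.
  by rewrite adj1.
pose line x : 'rV[{poly R}]_d.+1 :=
  map_mx polyC (P x) + 'X *: map_mx polyC (Q x - P x).
pose pt t x : 'rV[R]_d.+1 := P x + t *: (Q x - P x).
have lineE t s' : (\det (normal_mx line s')).[t] = \det (normal_mx (pt t) s').
  rewrite -[LHS]/(horner_eval t _) -det_map_mx map_normal_mx.
  congr (\det _); apply: eq_normal_mx => x; apply/rowP => a.
  by rewrite !mxE /= /horner_eval !hornerE.
(* The product makes one [t] serve all of [s :: ss]: the factor of [s] is nonzero at 1, where the
   line reaches [Q], and those of [ss] at 0, where it starts at [P]. *)
have [t] : exists t, (\prod_(s' <- s :: ss) \det (normal_mx line s')).[t] != 0.
  apply: poly_nonroot; rewrite prodf_seq_neq0; apply/allP => s'.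
  rewrite inE => /predU1P[->|s'ss]; apply/implyP => _.
    suff : (\det (normal_mx line s)).[1] != 0 by apply: contraNneq => ->; rewrite horner0.
    rewrite lineE (_ : normal_mx _ s = 1%:M) ?det1 ?oner_eq0// -Qs.
    by apply: eq_normal_mx => x; rewrite /pt scale1r addrC subrK.
  suff : (\det (normal_mx line s')).[0] != 0 by apply: contraNneq => ->; rewrite horner0.
  rewrite lineE (_ : normal_mx _ s' = normal_mx P s') ?Pss//.
  by apply: eq_normal_mx => x; rewrite /pt scale0r addr0.
rewrite horner_prod prodf_seq_neq0 => /allP tP.
exists (pt t) => [x|s' /tP]; last by rewrite lineE.
rewrite (eq_bigr (fun k => P x 0 k + t * (Q x 0 k - P x 0 k))) => [|k _];
  last by rewrite !mxE.
by rewrite big_split/= -mulr_sumr big_split/= sumrN Q1 P1 subrr mulr0 addr0.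
Qed.

(* Points of R^d are written on the hyperplane of R^(d+1) where the coordinates
   sum to 1, so that affine hulls become linear spans. *)
Lemma generic_points (T : finType) :
  exists2 P : T -> 'rV[R]_d.+1, (forall x, \sum_k P x 0 k = 1) &
    forall (F : 'I_d.+1 -> {set T}) (w : 'I_d.+1 -> T -> R) (u : 'rV[R]_d.+1),
      (forall i, (#|F i| <= d)%N) ->
      (forall i j, i != j -> [disjoint F i & F j]) ->
      (forall i, u = \sum_(x in F i) w i x *: P x) ->
    u = 0.
Proof.
pose I := ('I_d.+1 * 'I_d.+1)%type.
(* The points indexed by I pad sets with fewer than d elements. *)
have [|P P1 Pgen] := @generic_normals (T + I)%type
  [seq s : {ffun _ -> _} <- enum {: {ffun I -> T + I}} | injectiveb s].
  by move=> s; rewrite mem_filter => /andP[/injectiveP].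
exists (P \o inl) => [x|F w u Fd Fdisj uE]; first exact: P1.
(* [g] lists [F i] at indices other than [i], which suffice as [#|F i| <= d]. All remaining indices,
   [i] included, get the padding point [(i, j)], distinct for distinct pairs. *)
have key : forall i, exists g : 'I_d.+1 -> T + I,
    [/\ injective g,
        forall j, match g j return Prop with
                  | inl x => x \in F i
                  | inr p => p = (i, j)
                  end &
        forall x, x \in F i -> exists2 j, j != i & g j = inl x].
  move=> i.
  pose g (j : 'I_d.+1) : T + I :=
    if unlift i j is Some j' then
      (if insub (j' : nat) is Some m then inl (@enum_val T (mem (F i)) m)
       else inr (i, j))
    else inr (i, j).
  have gE j : match g j return Prop with
      | inl x => x \in F i /\ exists2 m : 'I_#|F i|, x = enum_val m &
                   exists2 j', unlift i j = Some j' & val j' = m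
      | inr p => p = (i, j) end.
    rewrite /g; case: unliftP => [j' ->|-> //].
    case: insubP => [m _ mE|_ //]; split; first exact: enum_valP.
    by exists m => //; exists j'.
  exists g; split=> [j1 j2 g12|j|x xF].
  - move: (gE j1) (gE j2); rewrite -g12.
    case: (g j1) => [x [_ [m -> [j ji jm]]]|p -> [->//]].
    move=> [_ [m' /enum_val_inj mm' [j' j'i j'm]]].
    move: ji j'i; do 2 case: unliftP => // ? ->; move=> [->] [->].
    by congr lift; apply: val_inj; rewrite jm mm' -j'm.
  - by move: (gE j); case: (g j) => // x [].
  - have mP : (enum_rank_in xF x < d)%N by apply: leq_trans (Fd i); apply: ltn_ord.
    exists (lift i (Ordinal mP)); first by rewrite eq_sym neq_lift.
    rewrite /g liftK insubT//= => lt; congr inl.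
    by rewrite (_ : Sub _ _ = enum_rank_in xF x) ?enum_rankK_in//; apply: val_inj.
have [g gP] := fin_all_exists key.
pose s := [ffun ij : I => g ij.1 ij.2].
have s_inj : injective s.
  move=> [i j] [i' j']; rewrite !ffunE/= => gij.
  have [g_inj gF _] := gP i.
  have [ii'|ii'] := eqVneq i i'.
    by rewrite -ii' in gij *; rewrite (g_inj _ _ gij).
  have [_ gF' _] := gP i'.
  move: (gF j) (gF' j'); rewrite -gij; case: (g i j) => [x|p -> [->->]//].
  by move=> xF; rewrite (disjointFr (Fdisj _ _ ii') xF).
have detN : \det (normal_mx P s) != 0.
  by apply: Pgen; rewrite mem_filter mem_enum andbT; apply/injectiveP.
have uN : u *m normal_mx P s = 0.
  apply: (@mul_normal_mx _ _ _ _ _ _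
    (fun i j => if g i j is inl x then w i x else 0)) => i.
  have [g_inj gF gS] := gP i.
  pose h (y : T + I) : 'rV[R]_d.+1 := if y is inl x then w i x *: P (inl x) else 0.
  rewrite [LHS](uE i) [RHS](_ : _ = \sum_(j | j != i) h (g i j)); last first.
    apply: eq_bigr => j _; rewrite /s ffunE/= /h.
    by case: (g i j) => // p; rewrite scale0r.
  transitivity (\sum_(x in F i) \sum_(j | (j != i) && (g i j == inl x)) h (g i j)).
    apply: eq_bigr => x xF; have [j ji gj] := gS x xF.
    rewrite (big_pred1 j) ?gj// => k; rewrite /= -gj (inj_eq g_inj).
    by case: (eqVneq k j) => [->|_]; rewrite ?ji ?andbF.
  rewrite (exchange_big_dep (fun j => j != i)) => [|x j _ /andP[]//].
  apply: eq_bigr => j ji; rewrite ji/=; move: (gF j); case: (g i j) => [x xF|p _]; last by rewrite big1.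
  rewrite (big_pred1 x)// => y; rewrite /= eq_sym.
  by rewrite (inj_eq (@inl_inj _ _)); case: eqVneq => [->|]; rewrite ?xF ?andbF.
have N_unit : normal_mx P s \in unitmx by rewrite unitmxE unitfE.
by rewrite -[u](mulmxK N_unit) uN mul0mx.
Qed.

End GenericPoints.

(** * Ranks and chains in a graded lattice *)

Section Rank.
Context {disp : Order.disp_t} {L : finTBLatticeType disp}.
Variable rk : L -> nat.
Hypothesis rk_rank : is_rank rk.
Implicit Types (x y z : L).

(** An element of the interval from [x] (excluded) to [y] with the smallest down-set covers [x]. *)
Lemma exists_cover x y : (x < y)%O -> exists2 z, covers x z & (z <= y)%O.
Proof.
move=> xy; have Py : (x < y <= y)%O by rewrite xy lexx.
case: (@arg_minnP _ y (fun z => (x < z <= y)%O)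
  (fun z => #|[set t | (t <= z)%O]|%SET) Py) => z /andP[xz zy] zmin; exists z => //; rewrite /covers xz; apply/forallP => t.
apply/negP => /andP[xt tz].
have := zmin t; rewrite xt (le_trans (ltW tz) zy) => /(_ isT).
rewrite leqNgt => /negP; apply; apply: proper_card; apply/properP; split.
  by apply/fintype.subsetP => s; rewrite !inE => /le_trans; apply; apply: ltW.
by exists z; rewrite !inE ?lexx// lt_geF.
Qed.

Lemma rank_lt x y : (x < y)%O -> (rk x < rk y)%N.
Proof.
have [n] := ubnP #|[set t | (x < t <= y)%O]|%SET.
elim: n x => // n IH x; rewrite ltnS => xyn xy.
have [z xz zy] := exists_cover xy.
rewrite -(rk_rank.2 _ _ xz); move: zy; rewrite le_eqVlt => /predU1P[->//|zy].
have {xz} /andP[xz _] := xz.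
apply/ltnW/IH => //; apply: leq_trans xyn; apply: proper_card; apply/properP; split.
  by apply/fintype.subsetP => s; rewrite !inE => /andP[/(lt_trans xz)-> ->].
by exists z; rewrite !inE ?ltxx// xz ltW.
Qed.

Lemma rank_le x y : (x <= y)%O -> (rk x <= rk y)%N.
Proof. by rewrite le_eqVlt => /predU1P[->//|/rank_lt/ltnW]. Qed.

(** The rank is injective on a chain. *)
Lemma card_chain (F : {set L}) d :
    {in F &, forall x y, (x >=< y)%O} -> {in F, forall x, (1 <= rk x <= d)%N} ->
  (#|F| <= d)%N.
Proof.
move=> Fchain Frk; rewrite -[leqRHS](size_iota 1) cardE -(size_map rk).
apply: uniq_leq_size => [|r /mapP[x]]; last first.
  by rewrite mem_enum mem_iota add1n ltnS => /Frk ? ->.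
rewrite map_inj_in_uniq ?enum_uniq// => x y; rewrite !mem_enum => xF yF rxy.
by case: (comparable_ltgtP (Fchain _ _ xF yF)) => // /rank_lt; rewrite rxy ltnn.
Qed.

Lemma atom_gt0 : {in atoms rk, forall a, (0 < rk a)%N}.
Proof. by move=> a; rewrite inE => /eqP->. Qed.

End Rank.

(** * Maximal disjoint subfamilies and double counting *)

Section Counting.
Local Open Scope nat_scope.
Variables (T U : finType).

Lemma maximal_disjoint_subfamily (B : {set T}) (F : T -> {set U}) (d : nat) :
    {in B, forall c, F c != finset.set0} ->
    (forall g : 'I_d.+1 -> T, (forall i, g i \in B) ->
      ~ (forall i j, i != j -> [disjoint F (g i) & F (g j)])) ->
  exists2 D : {set T}, D \subset B /\ #|D| <= d &
    {in B, forall c, exists2 e, e \in D & ~~ [disjoint F e & F c]}.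
Proof.
move=> F0 Fd.
pose ok (D : {set T}) := (D \subset B) &&
  [forall x in D, forall y in D, (x != y) ==> [disjoint F x & F y]].
have [|D /maxsetP[/andP[DB /forall_inP Ddis] Dmax]] := @ex_maxset _ ok.
  by exists finset.set0; rewrite /ok finset.sub0set; apply/forall_inP => x; rewrite inE.
exists D => [|c cB].
  split=> //; rewrite leqNgt; apply/negP => dD.
  apply: (Fd (fun i => enum_val (widen_ord dD i))) => [i|i j ij].
    exact: (fintype.subsetP DB) (enum_valP _).
  have /forall_inP := Ddis _ (enum_valP (widen_ord dD i)).
  move=> /(_ _ (enum_valP (widen_ord dD j)))/implyP.
  by apply; rewrite (inj_eq enum_val_inj) -(inj_eq val_inj).
have [|/exists_inPn disj] := boolP [exists e in D, ~~ [disjoint F e & F c]].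
  by case/exists_inP => e; exists e.
(* A [c] whose set is disjoint from those of all members of [D] could be added to [D], so by
   maximality it is in [D]; it then meets itself, [F c] being nonempty. *)
exists c; last by rewrite -finset.setI_eq0 finset.setIid F0.
suff <- : (c |: D)%SET = D by rewrite !inE eqxx.
apply: Dmax; last exact: finset.subsetUr.
rewrite /ok finset.subUset finset.sub1set cB DB.
apply/forall_inP => x; rewrite !inE => xcD.
apply/forall_inP => y; rewrite !inE => ycD; apply/implyP => xy.
case/predU1P: xcD xy => [->|xD]; case/predU1P: ycD => [->|yD]; rewrite ?eqxx// => xy.
- by rewrite disjoint_sym; move: (disj _ yD); rewrite negbK.
- by move: (disj _ xD); rewrite negbK.
- by have /forall_inP/(_ _ yD)/implyP := Ddis _ xD; apply.
Qed.

(** Double counting: an element of [C] lies in at most [d] of the [d.+1] sets, or in all of them and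
    then counts once more. *)
Lemma sum_card_le (d : nat) (S : 'I_d.+1 -> {set U}) (C : {set U}) :
    (forall i, S i \subset C) ->
  \sum_i #|S i| <= d * #|C| + #|[set c in C | [forall i, c \in S i]]%SET|.
Proof.
move=> SC.
have -> : \sum_i #|S i| = \sum_(c in C) #|[set i | c \in S i]%SET|.
  under [RHS]eq_bigr do rewrite -sum1dep_card.
  rewrite [RHS](exchange_big_dep xpredT)//=; apply: eq_bigr => i _.
  rewrite -sum1_card; apply: eq_bigl => c; have := fintype.subsetP (SC i) c.
  by case: (c \in S i) => [->//|_]; rewrite andbF.
rewrite mulnC -sum_nat_const -sum1dep_card big_mkcondr -big_split /=.
apply: leq_sum => c _; case: ifPn => [_|/forallPn[i ci]].
  by rewrite addn1 (leq_trans (max_card _))// card_ord.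
rewrite addn0 -ltnS -[X in _ < X](card_ord d.+1).
apply: proper_card; apply/properP; split.
  exact/fintype.subsetP.
by exists i; rewrite // inE.
Qed.

End Counting.

Lemma min_Gamma_le (disp : Order.disp_t) (L : finTBLatticeType disp) (rk : L -> nat)
    (d m : nat) (Z : {set L}) : Z \subset atoms rk -> #|Z| = m ->
  (min_Gamma rk d m <= #|Gamma rk d Z|)%N.
Proof.
move=> ZA Zm; rewrite /min_Gamma.
elim: (index_enum _) (mem_index_enum Z) => // Z' r IH.
rewrite inE big_cons => /predU1P[<-|Zr]; first by rewrite ZA Zm eqxx geq_minl.
by case: ifP => _; [apply: leq_trans (geq_minr _ _) (IH Zr)|apply: IH].
Qed.

(** * A continuous map supported by the barycentric subdivision *)

Section Subdivision.
Variables (R : realType) (T : finType).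
Implicit Types (x : {ptws T -> R}) (s t : {set T}) (u v : T).

(* The faces with nonzero weight at x form the simplex of the barycentric
   subdivision whose relative interior contains x.  The empty face has weight 1
   and is excluded everywhere. *)
Definition face_weight x s : R :=
  \prod_(v in s) (Num.max 0 (x v) * \prod_(u | u \notin s) Num.max 0 (x v - x u)).

Definition flag x : {set {set T}} :=
  [set s | (s != finset.set0) && (face_weight x s != 0)].

Definition total_weight x : R := \sum_(s | s != finset.set0) face_weight x s.

Lemma continuous_face_weight s : continuous (face_weight ^~ s).
Proof.
move=> x.
have ev v : {for x, continuous (fun z : {ptws T -> R} => z v : R^o)}.
  exact: (@proj_continuous T (fun=> R) v).
have mulc : continuous (fun z : R^o * R^o => z.1 * z.2 : R^o).
  exact: mul_continuous.
refine (@cvg_big R^o T *%R 1 (fun v => v \in s) mulc _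
  (nbhs x) (index_enum T) _ _ _ _) => v _.
apply: cvgM.
  apply: (@continuous_max R _ (fun=> 0) (fun z : {ptws T -> R} => z v)) => //.
  exact: cst_continuous.
refine (@cvg_big R^o T *%R 1 (fun v => v \notin s) mulc _
  (nbhs x) (index_enum T) _ _ _ _) => u _.
apply: (@continuous_max R _ (fun=> 0) (fun z : {ptws T -> R} => z v - z u)).
  exact: cst_continuous.
exact: (@continuousB _ _ _ (fun z : {ptws T -> R} => z v : R^o)
  (fun z : {ptws T -> R} => z u : R^o) x (ev v) (ev u)).
Qed.

Lemma max0_neq0 (a : R) : (Num.max 0 a != 0) = (0 < a).
Proof.
by rewrite /Num.max; case: ltgtP => [a0|_|_]; rewrite ?eqxx// gt_eqF.
Qed.

(** The nonempty [s] of this kind are the superlevel sets of [x] at positive thresholds, which is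
    why [flag x] is a chain. *)
Lemma face_weight_neq0P x s :
  reflect (forall v, v \in s -> 0 < x v /\ forall u, u \notin s -> x u < x v)
          (face_weight x s != 0).
Proof.
apply: (iffP (prodf_neq0 _ _)) => [xs v /xs|xs v /xs[xv xu]].
  rewrite mulf_eq0 negb_or max0_neq0 => /andP[-> /prodf_neq0 xu]; split=> // u /xu.
  by rewrite max0_neq0 subr_gt0.
rewrite mulf_neq0 ?max0_neq0//; apply/prodf_neq0 => u /xu.
by rewrite max0_neq0 subr_gt0.
Qed.

Lemma face_weight_ge0 x s : 0 <= face_weight x s.
Proof.
apply: prodr_ge0 => v _; rewrite mulr_ge0 ?le_max ?lexx//.
by apply: prodr_ge0 => u _; rewrite le_max lexx.
Qed.

Lemma flag_comparable x : {in flag x &, forall s t, (s \subset t) || (t \subset s)}.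
Proof.
move=> s t; rewrite !inE => /andP[_ /face_weight_neq0P xs] /andP[_ /face_weight_neq0P xt].
apply/orP; have [st|/subsetPn[v vs vt]] := boolP (s \subset t); [by left|right].
apply/fintype.subsetP => u ut; apply: contraT => us.
by have := lt_trans ((xs v vs).2 u us) ((xt u ut).2 v vt); rewrite ltxx.
Qed.

Lemma flag_subset x s : s \in flag x -> s \subset [set v | x v != 0]%SET.
Proof.
rewrite inE => /andP[_ /face_weight_neq0P xs]; apply/fintype.subsetP => v /xs[xv _].
by rewrite inE gt_eqF.
Qed.

Section Simplex.
Variable x : {ptws T -> R}.
Hypothesis x_ge0 : forall v, 0 <= x v.
Hypothesis x_sum : \sum_v x v = 1.

Lemma exists_max_coordinate : exists2 v, 0 < x v & forall u, x u <= x v.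
Proof.
have [v xv] : exists v, 0 < x v.
  apply: contrapT => /forallNP x0; have := oner_neq0 R.
  rewrite -x_sum big1 ?eqxx// => v _; apply/eqP; rewrite eq_le x_ge0 andbT leNgt.
  exact/negP.
case: (@arg_maxP _ _ _ v xpredT x isT) => w _ xw; exists w => [|u]; last exact: xw.
by apply: lt_le_trans xv _; apply: xw.
Qed.

(** A vertex of largest coordinate lies in every nonempty superlevel set. Its atom will bound a
    whole chain from below. *)
Lemma flag_common_vertex : exists v, {in flag x, forall s, v \in s}.
Proof.
have [v xv vmax] := exists_max_coordinate; exists v => s.
rewrite inE => /andP[/finset.set0Pn[u us] /face_weight_neq0P xs].
by apply: contraT => /((xs u us).2); rewrite ltNge vmax.
Qed.

Lemma flag_neq0 : flag x != finset.set0.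
Proof.
have [v xv vmax] := exists_max_coordinate.
apply/finset.set0Pn; exists [set u | x u == x v]%SET; rewrite inE; apply/andP; split.
  by apply/finset.set0Pn; exists v; rewrite inE.
apply/face_weight_neq0P => w; rewrite inE => /eqP->; split=> // u; rewrite inE => ux.
by rewrite lt_neqAle ux vmax.
Qed.

Lemma total_weight_neq0 : total_weight x != 0.
Proof.
have /finset.set0Pn[s] := flag_neq0; rewrite inE => /andP[s0 ws].
apply/negP => /eqP/psumr_eq0P w0; move: ws.
by rewrite w0 ?eqxx// => t _; apply: face_weight_ge0.
Qed.

End Simplex.

Variables (V : normedModType R) (p : {set T} -> V).

(** The weights are products, so this is not the affine interpolation. It is enough that they are
    continuous and that, on the realization, the value is a convex combination of the [p s] with [s]
    in [flag x]. *)
Definition subdivision_map x : V :=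
  (total_weight x)^-1 *: \sum_(s | s != finset.set0) face_weight x s *: p s.

Lemma subdivision_map_flag x : subdivision_map x =
  \sum_(s in flag x) (total_weight x)^-1 * face_weight x s *: p s.
Proof.
rewrite /subdivision_map big_mkcond scaler_sumr [RHS]big_mkcond /=.
apply: eq_bigr => s _; rewrite inE; case: (s != finset.set0); rewrite ?scaler0//=.
by case: eqP => [->|_]; rewrite ?scale0r ?scaler0// scalerA.
Qed.

Lemma sum_flag_weights x : total_weight x != 0 ->
  \sum_(s in flag x) (total_weight x)^-1 * face_weight x s = 1.
Proof.
move=> x0; rewrite -mulr_sumr -[RHS](mulVf x0); congr (_ * _).
rewrite /total_weight big_mkcond [RHS]big_mkcond /=.
by apply: eq_bigr => s _; rewrite inE; case: (s != finset.set0) => //=; case: eqP.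
Qed.

Lemma continuous_subdivision_map x : total_weight x != 0 ->
  {for x, continuous subdivision_map}.
Proof.
move=> x0.
have addc (W : normedModType R) : continuous (fun z : W * W => z.1 + z.2 : W).
  exact: add_continuous.
apply: (@continuousZ _ _ _ (fun y => (total_weight y)^-1)
  (fun y => \sum_(s | s != finset.set0) face_weight y s *: p s)).
  refine (@continuousV _ _ total_weight x x0 _).
  refine (@cvg_big R^o _ +%R 0 (fun s => s != finset.set0) (addc R^o) _
    (nbhs x) (index_enum _) _ _ _ _) => s _.
  exact: continuous_face_weight.
refine (@cvg_big V _ +%R 0 (fun s => s != finset.set0) (addc V) _
  (nbhs x) (index_enum _) _ _ _ _) => s _.
apply: (@continuousZr_tmp _ _ _ (face_weight^~ s)); exact: continuous_face_weight.
Qed.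

End Subdivision.

(** * Passage to the hyperplane of coordinate sum 1 *)

Section AffineLift.
Variables (R : comNzRingType) (d : nat).

(** Inverse, on the hyperplane of coordinate sum 1, of dropping coordinate 0 by [col' ord0]. *)
Definition affine_lift (u : 'rV[R]_d) : 'rV[R]_d.+1 :=
  \row_k if unlift ord0 k is Some j then u 0 j else 1 - \sum_j u 0 j.

Lemma affine_lift_neq0 u : affine_lift u != 0.
Proof.
apply: contra_neq (oner_neq0 R) => u0.
rewrite -[LHS](subrK (\sum_j u 0 j)).
transitivity (\sum_k affine_lift u 0 k); last by rewrite u0 big1// => k _; rewrite mxE.
rewrite big_ord_recl mxE unlift_none; congr (_ + _).
by apply: eq_bigr => j _; rewrite mxE liftK.
Qed.

(** Coefficients of sum 1 keep the combination on the hyperplane, where the lift undoes the linear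
    map [col' ord0]. *)
Lemma affine_lift_comb (I : finType) (A : {set I}) (c : I -> R) (Q : I -> 'rV[R]_d.+1) :
    (forall i, \sum_k Q i 0 k = 1) -> \sum_(i in A) c i = 1 ->
  affine_lift (\sum_(i in A) c i *: col' ord0 (Q i)) = \sum_(i in A) c i *: Q i.
Proof.
move=> Q1 c1; set q := \sum_(i in A) c i *: Q i.
have q1 : \sum_k q 0 k = 1.
  rewrite -[RHS]c1; under eq_bigr do rewrite summxE; rewrite exchange_big.
  by apply: eq_bigr => i _; under eq_bigr do rewrite mxE; rewrite -mulr_sumr Q1 mulr1.
have -> : \sum_(i in A) c i *: col' ord0 (Q i) = col' ord0 q.
  apply/rowP => j; rewrite mxE !summxE; by apply: eq_bigr => i _; rewrite !mxE.
apply/rowP => k; rewrite mxE; case: unliftP => [j ->|->]; first by rewrite mxE.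
rewrite -q1 big_ord_recl (eq_bigr (fun j => col' ord0 q 0 j)) ?addrK// => j _.
by rewrite mxE.
Qed.

End AffineLift.

(** * The map attached to the lattice and its common coatoms *)

Section LatticeMap.
Variables (R : realType) (d n : nat).
Context {disp : Order.disp_t} {L : finTBLatticeType disp}.
Variable rk : L -> nat.
Hypothesis rk_rank : is_rank rk.
Variable P : L -> 'rV[R]_d.+1.
Hypothesis P_sum : forall y, \sum_k P y 0 k = 1.
Variable alpha : vertex d n -> L.
Hypothesis alpha_atom : forall v, alpha v \in atoms rk.

Definition face_join (s : {set vertex d n}) : L := (\join_(v in s) alpha v)%O.

Definition lattice_map : {ptws vertex d n -> R} -> 'rV[R]_d :=
  subdivision_map (fun s => col' ord0 (P (face_join s))).

Lemma continuous_lattice_map : continuous_on_join lattice_map.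
Proof.
rewrite /continuous_on_join; apply: continuous_in_subspaceT => x.
rewrite inE => -[x0 x1 _].
exact/continuous_subdivision_map/total_weight_neq0.
Qed.

(** For a preimage [x] of [u], the joins of the faces in [flag x] form a chain. It lies above the
    atom of a common vertex and below [c], so its ranks are between 1 and [d]. *)
Lemma lattice_map_chain (u : 'rV[R]_d) (z : 'I_d.+1 -> vertex d n) (c : L) :
    rk c = d -> (forall i, (alpha (z i) <= c)%O) ->
    (lattice_map @` geom_simplex (R := R) [set z i | i in 'I_d.+1]%SET)%classic u ->
  exists (F : {set L}) (w : L -> R) (a : L),
    [/\ a \in atoms rk, F != finset.set0, (#|F| <= d)%N,
        {in F, forall y, (a <= y <= c)%O}
      & affine_lift u = \sum_(y in F) w y *: P y].
Proof.
move=> rkc zc [x [x0 x1 xz] <-].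
pose F := (face_join @: flag x)%SET.
have [v vP] := flag_common_vertex x0 x1.
have Fac : {in F, forall y, (alpha v <= y <= c)%O}.
  move=> _ /imsetP[s sx ->]; apply/andP; split; first exact/joins_sup/vP.
  apply/joinsP => t ts.
  have /fintype.subsetP/(_ _ (fintype.subsetP (flag_subset sx) _ ts)) := xz.
  by case/imsetP => i _ ->.
pose q s := (total_weight x)^-1 * face_weight x s.
(* Different faces may have the same join, so weights are summed over the fibres of [face_join]. *)
exists F, (fun y => \sum_(s in flag x | face_join s == y) q s), (alpha v); split=> //.
- have /finset.set0Pn[s sx] := flag_neq0 x0 x1.
  by apply/finset.set0Pn; exists (face_join s); apply: imset_f.
- apply: (@card_chain _ _ rk rk_rank) => [y y'|y /Fac/andP[ay yc]].
    move=> /imsetP[s sx ->] /imsetP[t tx ->].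
    by apply/orP; case/orP: (flag_comparable sx tx) => ?; [left|right]; apply: le_joins.
  rewrite -rkc (rank_le rk_rank yc) andbT.
  exact: leq_trans (atom_gt0 (alpha_atom v)) (rank_le rk_rank ay).
- rewrite /lattice_map subdivision_map_flag affine_lift_comb//; last first.
    exact/sum_flag_weights/total_weight_neq0.
  rewrite (partition_big_imset face_join)/=; apply: eq_bigr => y _.
  by rewrite scaler_suml; apply: eq_bigr => s /andP[_ /eqP->].
Qed.

Hypothesis P_generic :
  forall (F : 'I_d.+1 -> {set L}) (w : 'I_d.+1 -> L -> R) (u : 'rV[R]_d.+1),
    (forall i, (#|F i| <= d)%N) ->
    (forall i j, i != j -> [disjoint F i & F j]) ->
    (forall i, u = \sum_(x in F i) w i x *: P x) ->
  u = 0.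

Lemma card_common_coatoms (Z : 'I_d.+1 -> {set vertex d n}) :
    (\bigcap_(z in [set z : 'I_d.+1 -> vertex d n | forall i, z i \in Z i])
       (lattice_map @` geom_simplex (R := R) [set z i | i in 'I_d.+1]%SET)
     !=set0)%classic ->
  (#|[set c in coatoms rk d | [forall i, c \in Gamma rk d (alpha @: Z i)]]%SET|
     <= d * max_coatoms_above rk d)%N.
Proof.
case=> u uP; set B := [set c in _ | _]%SET.
have /choice[F FP] : forall c, exists Fwa : {set L} * (L -> R) * L, c \in B ->
    [/\ Fwa.2 \in atoms rk, Fwa.1.1 != finset.set0, (#|Fwa.1.1| <= d)%N,
        {in Fwa.1.1, forall y, (Fwa.2 <= y <= c)%O}
      & affine_lift u = \sum_(y in Fwa.1.1) Fwa.1.2 y *: P y].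
  move=> c; have [|cB] := boolP (c \in B); last by exists (finset.set0, fun=> 0, c).
  rewrite inE => /andP[]; rewrite inE => /eqP cd /forallP cZ.
  have /fin_all_exists2[z zZ zc] : forall i, exists2 v, v \in Z i & (alpha v <= c)%O.
    move=> i; have /finset.bigcupP[_ /imsetP[v vZ ->]] := cZ i.
    by rewrite inE => /andP[_ ?]; exists v.
  have [F [w [a ?]]] := lattice_map_chain cd zc (uP z zZ).
  by exists (F, w, a).
have [c cB|g gB disj|D [DB Dd] DP] :=
  @maximal_disjoint_subfamily _ _ B (fun c => (F c).1.1) d.
- by have [] := FP c cB.
(* With [d.+1] disjoint chains, genericity would make the lift of [u] zero. *)
- have /eqP := affine_lift_neq0 u; apply.
  apply: (P_generic (w := fun i => (F (g i)).1.2) _ disj) => i.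
    by have [] := FP _ (gB i).
  by have [] := FP _ (gB i).
(* If the chains of [e] and [c] share [y], the atom of [e] is below [y], hence below [c]. *)
have BD : B \subset (\bigcup_(e in D) coatoms_above rk d (F e).2)%SET.
  apply/fintype.subsetP => c cB; have [e eD] := DP c cB.
  rewrite -finset.setI_eq0 => /finset.set0Pn[y]; rewrite inE => /andP[ye yc].
  apply/finset.bigcupP; exists e => //; rewrite inE.
  have [_ _ _ /(_ _ ye)/andP[ey _] _] := FP e (fintype.subsetP DB _ eD).
  have [_ _ _ /(_ _ yc)/andP[_ yc'] _] := FP c cB.
  by rewrite (le_trans ey yc') andbT; move: cB; rewrite inE => /andP[].
apply: (leq_trans (subset_leq_card BD)).
apply: (@leq_trans (\sum_(e in D) max_coatoms_above rk d)); last first.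
  by rewrite sum_nat_const leq_mul2r Dd orbT.
elim/big_rec2: _ => [|e m A eD Am]; first by rewrite finset.cards0.
apply: leq_trans (leq_card_setU _ _) (leq_add _ Am); apply: leq_bigmax_cond.
by have [] := FP e (fintype.subsetP DB _ eD).
Qed.

End LatticeMap.

(** * Assembling the inequality *)

Theorem theorem2p1 (R : realType) (d n : nat) (hd : (1 <= d)%N) (hn : (1 <= n)%N)
    (disp : Order.disp_t) (L : finTBLatticeType disp) (rk : L -> nat)
    (hrk : is_rank rk) (hL : rk \top%O = d.+1)
    (hA : (n * d.+1 <= #|atoms rk|)%N) :
  (min_Gamma rk d (tau R d n))%:R
    <= d%:R / d.+1%:R * (max_coatoms_above rk d + #|coatoms rk d|)%:R :> R.
Proof.
have [P P1 Pgen] := @generic_points R d L.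
have [alpha alpha_inj alpha_atom] :
    exists2 alpha : vertex d n -> L, injective alpha & forall v, alpha v \in atoms rk.
  have le : (#|vertex d n| <= #|atoms rk|)%N by rewrite card_prod !card_ord mulnC.
  exists (fun v => enum_val (widen_ord le (enum_rank v))) => [v v'|v]; last exact: enum_valP.
  by move=> /enum_val_inj/(congr1 val)/= /val_inj/enum_rank_inj.
pose f : {ptws vertex d n -> R} -> 'rV[R]_d := lattice_map P alpha.
have tau_f : (tau R d n <= tau_map f)%N.
  rewrite /tau; case: ex_minnP => m _; apply; apply/asboolP; exists f => //.
  exact: continuous_lattice_map.
have : pach f (tau_map f).
  (* With empty sets the intersection has no constraint; so the maximum defining [tau_map f] runs
     over a nonempty set and is attained. *)
  have pach0 : pach f 0.
    exists (fun=> finset.set0); split=> [i|].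
      by rewrite finset.sub0set finset.cards0.
    by exists 0 => z zZ; have := zZ ord0; rewrite inE.
  rewrite /tau_map.
  have [|m mP ->] := @eq_bigmax_cond _
    [pred m : 'I_n.+1 | `[< pach f m >]] (fun m => m : nat).
    by apply/card_gt0P; exists ord0; rewrite inE.
  by move: mP; rewrite inE.
case=> Z [ZV uP].
(* [Z i] has [tau_map f] elements, possibly more than [tau R d n]; its image is trimmed to that
   size, and [Gamma] is monotone. *)
have /fin_all_exists2[Y YZ Ym] : forall i, exists2 Y : {set L},
    Y \subset (alpha @: Z i)%SET & #|Y| = tau R d n.
  move=> i; have Zi : (tau R d n <= #|(alpha @: Z i)%SET|)%N.
    by rewrite card_imset// (ZV i).2.
  have : (0 < #|[set Y : {set L} | Y \subset (alpha @: Z i)%SET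
                                 & #|Y| == tau R d n]%SET|)%N.
    by rewrite cards_draws bin_gt0.
  by case/card_gt0P => Y; rewrite inE => /andP[YZ /eqP]; exists Y.
pose S i := Gamma rk d (alpha @: Z i)%SET.
have minS i : (min_Gamma rk d (tau R d n) <= #|S i|)%N.
  apply: (@leq_trans #|Gamma rk d (Y i)|); last first.
    apply: subset_leq_card; apply/finset.bigcupsP => y yY.
    by apply: (finset.bigcup_sup y) => //; apply: (fintype.subsetP (YZ i)).
  apply: min_Gamma_le => //; apply: (fintype.subset_trans (YZ i)).
  by apply/fintype.subsetP => _ /imsetP[v _ ->].
have SC i : S i \subset coatoms rk d.
  by apply/finset.bigcupsP => y _; apply/fintype.subsetP => c; rewrite inE => /andP[].
(* Each of the [d.+1] sets [S i] has at least the minimum size; the sum of their sizes is bounded by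
   double counting. *)
have key : (d.+1 * min_Gamma rk d (tau R d n)
    <= d * (max_coatoms_above rk d + #|coatoms rk d|))%N.
  rewrite -[d.+1 in leqLHS]card_ord -sum_nat_const.
  apply: (leq_trans (leq_sum _ (fun i _ => minS i))).
  apply: (leq_trans (sum_card_le SC)); rewrite mulnDr addnC leq_add2r.
  exact: (card_common_coatoms hrk P1 alpha_atom Pgen uP).
rewrite -mulrA mulrCA mulrC ler_pdivlMr ?ltr0n// mulrC.
by rewrite -!natrM ler_nat.
Qed.
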